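(* Let $g=(g_1,\dots,g_n)$ be a square system of polynomials in $\mathbb{C}[x_1,\dots,x_n]$, and let $(\hat\zeta,\rho,\mathcal{N}_g)$ be an approximate solution to $g$ with associated solution $\zeta$. For any polynomial $f\in\mathbb{C}[x_1,\dots,x_n]$, if $$|f(\hat\zeta)|-\sum_{k=1}^{\deg f}\frac{\|(D^k f)_{\hat\zeta}\|}{k!}\,\rho^k>0,$$ then $f(\zeta)\neq 0$.
   Context: For a polynomial system $h$ in $n$ variables, $\mathcal{V}(h)\subset\mathbb{C}^n$ is the set of common zeros; the system is square if it consists of $n$ polynomials. $\|\cdot\|$ on $\mathbb{C}^n$ is the usual Hermitian norm. Approximate solution: a ($\rho$-)approximate solution to a polynomial system $h$ is a triple $(\hat\zeta,\rho,\mathcal{N}_h)$ with $\hat\zeta\in\mathbb{C}^n$, $\rho\in\mathbb{R}_{>0}$, and $\mathcal{N}_h\colon U\to\mathbb{C}^n$ a map defined on some $U\subset\mathbb{C}^n$, such that (1) there exists $\zeta\in\mathcal{V}(h)$ with $\|\zeta-\hat\zeta\|<\rho$, and (2) all iterates $\mathcal{N}_h^k(\hat\zeta)$ are defined and the sequence $\mathcal{N}_h^k(\hat\zeta)$ converges to this $\zeta$ as $k\to\infty$. The point $\zeta$ is called the solution to $h$ associated to $\hat\zeta$. Norms of derivatives: for $k\in\mathbb{N}$, $S^k\mathbb{C}^n$ is the $k$-th symmetric power of $\mathbb{C}^n$, equipped with the norm dual to the standard unitarily invariant norm on homogeneous polynomials of degree $k$; it satisfies $\|z^k\|\le\|z\|^k$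 for $z\in\mathbb{C}^n$. The $k$-th derivative of $f$ at a point $p$ is regarded as the linear map $(D^kf)_p\colon S^k\mathbb{C}^n\to\mathbb{C}$ (sending $v_1\cdots v_k$ to the iterated directional derivative of $f$ at $p$ along $v_1,\dots,v_k$), and $\|(D^kf)_p\|=\max\{|(D^kf)_p(w)| : w\in S^k\mathbb{C}^n,\ \|w\|=1\}$ is its operator norm. *)

(* Defs.v *)
From mathcomp Require Import all_boot all_order all_algebra.
From mathcomp Require Import complex mpoly.
From mathcomp Require Import boolp classical_sets functions reals topology.
From mathcomp Require Import normedtype.
From mathcomp Require Import bigenough ssrcomplements.

Set Implicit Arguments.
Unset Strict Implicit.
Unset Printing Implicit Defensive.

Import Order.TTheory GRing.Theory Num.Theory BigEnough.
Import ComplexField.Normc.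
Import numFieldNormedType.Exports.

Local Open Scope classical_set_scope.
Local Open Scope complex_scope.
Local Open Scope ring_scope.

(* The complex numbers are R[i] for R : realType; normc is the modulus, with
   values in R.  A point z of C^n is a row vector, and z ord0 is its family of
   coordinates, at which polynomials are evaluated. *)

Definition hermitian_norm (R : realType) (n : nat) (z : 'rV[R[i]]_n) : R :=
  Num.sqrt (\sum_(j < n) normc (z ord0 j) ^+ 2).

Definition zero_locus (R : realType) (m n : nat)
    (h : m.-tuple {mpoly R[i][n]}) : set 'rV[R[i]]_n :=
  [set z | forall j : 'I_m, (tnth h j).@[z ord0] = 0].

(* N is a genuinely partial map, defined on the type of elements of U, so x
   being such a sequence contains the assertion that all N^k(x0) are defined. *)
Definition iterates (T : Type) (U : set T) (N : U -> T) (x0 : T)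
    (x : nat -> T) : Prop :=
  x 0%N = x0 /\ forall k, exists2 u : U, \val u = x k & x k.+1 = N u.

Definition associated_solution (R : realType) (n : nat)
    (h : n.-tuple {mpoly R[i][n]}) (zhat : 'rV[R[i]]_n) (rho : R)
    (U : set 'rV[R[i]]_n) (N : U -> 'rV[R[i]]_n) (zeta : 'rV[R[i]]_n) : Prop :=
  [/\ zero_locus h zeta,
      hermitian_norm (zeta - zhat) < rho
    & exists2 x : nat -> 'rV[R[i]]_n, iterates N zhat x
        & (fun k => hermitian_norm (x k - zeta)) @ \oo --> (0 : R)].

Definition approximate_solution (R : realType) (n : nat)
    (h : n.-tuple {mpoly R[i][n]}) (zhat : 'rV[R[i]]_n) (rho : R)
    (U : set 'rV[R[i]]_n) (N : U -> 'rV[R[i]]_n) : Prop :=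
  0 < rho /\ exists zeta, associated_solution h zhat rho N zeta.

(* The symmetric algebra of C^n is the polynomial ring in the standard basis
   vectors e_0, ..., e_(n-1), here written 'X_0, ..., 'X_(n-1); its degree k
   part is S^k C^n.  The same type also carries homogeneous polynomial
   functions of degree k on C^n; the two roles are kept apart by the names w
   (symmetric tensor) and h (form). *)
Definition sympow (R : realType) (n k : nat) := dhomog n R[i] k.

(* The vector v as an element of the symmetric algebra, so that the product
   v_1 ... v_k in S^k C^n is \prod_i symvec v_i. *)
Definition symvec (R : realType) (n : nat) (v : 'rV[R[i]]_n) :
    {mpoly R[i][n]} :=
  \sum_(j < n) v ord0 j *: 'X_j.

Definition dirderiv (R : realType) (n : nat) (v : 'rV[R[i]]_n)
    (f : {mpoly R[i][n]}) : {mpoly R[i][n]} :=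
  \sum_(j < n) v ord0 j *: f^`M(j).

(* (D^k f)_p, the linear extension of e^m |-> (d^m f)(p) to all of S^k C^n.
   By symdiff_prod it is the map v_1 ... v_k |-> (d_v1 ... d_vk f)(p). *)
Definition symdiff (R : realType) (n k : nat) (f : {mpoly R[i][n]})
    (p : 'rV[R[i]]_n) (w : sympow R n k) : R[i] :=
  \sum_(m <- msupp (val w)) (val w)@_m * (f^`M[m]).@[p ord0].

Lemma symdiffwE (R : realType) (n k b : nat) (f : {mpoly R[i][n]})
    (p : 'rV[R[i]]_n) (w : sympow R n k) : (msize (val w) <= b)%N ->
  symdiff f p w =
  \sum_(m : 'X_{1..n < b}) (val w)@_m * (f^`M[m]).@[p ord0].
Proof.
move=> le_wb; rewrite /symdiff (big_mksub 'X_{1..n < b}) /=; first last.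
- by move=> m /msize_mdeg_lt/leq_trans; apply.
- exact: msupp_uniq.
rewrite big_rmcond //= => m /memN_msupp_eq0 ->.
by rewrite mul0r.
Qed.

Lemma symdiff_is_linear (R : realType) (n k : nat) (f : {mpoly R[i][n]})
    (p : 'rV[R[i]]_n) (c : R[i]) (w1 w2 : sympow R n k) :
  symdiff f p (c *: w1 + w2) = c * symdiff f p w1 + symdiff f p w2.
Proof.
pose_big_enough b.
  rewrite !(@symdiffwE _ _ _ b) // mulr_sumr -big_split; apply: eq_bigr => m _.
  by rewrite /= mcoeffD mcoeffZ mulrDl mulrA.
by close.
Qed.

Lemma symdiff_prod (R : realType) (n k : nat) (f : {mpoly R[i][n]})
    (p : 'rV[R[i]]_n) (w : sympow R n k) (v : seq 'rV[R[i]]_n) :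
    val w = \prod_(u <- v) symvec u ->
  symdiff f p w = (foldr (@dirderiv R n) f v).@[p ord0].
Proof.
pose act (q : {mpoly R[i][n]}) := \sum_(m <- msupp q) q@_m *: f^`M[m].
have actE q b : (msize q <= b)%N ->
    act q = \sum_(m : 'X_{1..n < b}) q@_m *: f^`M[m].
  move=> le_qb; rewrite /act (big_mksub 'X_{1..n < b}) /=; first last.
  - by move=> m /msize_mdeg_lt/leq_trans; apply.
  - exact: msupp_uniq.
  rewrite big_rmcond //= => m /memN_msupp_eq0 ->.
  by rewrite scale0r.
have act_lin c q1 q2 : act (c *: q1 + q2) = c *: act q1 + act q2.
  pose_big_enough b.
    rewrite !(@actE _ b) // scaler_sumr -big_split; apply: eq_bigr => m _.
    by rewrite /= mcoeffD mcoeffZ scalerDl scalerA.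
  by close.
have act0 : act 0 = 0 by rewrite /act msupp0 big_nil.
have actZ c q : act (c *: q) = c *: act q.
  by rewrite -[c *: q]addr0 act_lin act0 addr0.
have actD q1 q2 : act (q1 + q2) = act q1 + act q2.
  by rewrite -[q1]scale1r act_lin !scale1r.
have act_sum (I : Type) (s : seq I) F :
    act (\sum_(j <- s) F j) = \sum_(j <- s) act (F j).
  by apply: (big_morph act).
have actX m : act 'X_[m] = f^`M[m].
  by rewrite /act msuppX big_seq1 mcoeffX eqxx scale1r.
have act_vec u q : act (symvec u * q) = dirderiv u (act q).
  rewrite /symvec mulr_suml act_sum; apply: eq_bigr => j _.
  rewrite -scalerAl actZ; congr (_ *: _).
  rewrite [q in LHS]mpolyE mulr_sumr act_sum.
  rewrite {2}/act raddf_sum; apply: eq_bigr => m _ /=.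
  rewrite -scalerAr actZ -mpolyXD actX mderivZ; congr (_ *: _).
  by rewrite addmC mderivmDm mderivmU1m -!mderivmU1m -!mderivmDm addmC.
move=> def_w; have -> : symdiff f p w = (act (val w)).@[p ord0].
  by rewrite /act raddf_sum; apply: eq_bigr => m _; rewrite /= mevalZ.
rewrite {}def_w; congr (_.@[_]).
elim: v => [|u v IHv]; last by rewrite big_cons act_vec IHv.
by rewrite big_nil -mpolyX0 actX mderivm0m.
Qed.

(* The unitarily invariant (Bombieri-Weyl) norm of a form h of degree k:
   |h|^2 is the sum of |h_m|^2 / (k choose m), with (k choose m) the
   multinomial coefficient. *)
Definition form_norm (R : realType) (n k : nat) (h : sympow R n k) : R :=
  Num.sqrt (\sum_(m <- msupp (val h))
    normc (val h)@_m ^+ 2 * (\prod_(j < n) (m j)`!%:R / k`!%:R)).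

(* The duality between forms of degree k and S^k C^n for which h paired with
   z^k is h(z), i.e. evaluation of the polarization of h; see pairing_pow. *)
Definition pairing (R : realType) (n k : nat) (h w : sympow R n k) : R[i] :=
  (k`!%:R)^-1 * symdiff (val h) 0 w.

Lemma pairing_pow (R : realType) (n k : nat) (h w : sympow R n k)
    (z : 'rV[R[i]]_n) :
  val w = symvec z ^+ k -> pairing h w = (val h).@[z ord0].
Proof.
move=> def_w.
have dX (m : 'X_{1..n}) : (dirderiv z 'X_[m]).@[z ord0] =
    (mdeg m)%:R * ('X_[m] : {mpoly R[i][n]}).@[z ord0].
  rewrite /dirderiv raddf_sum mdegE natr_sum mulr_suml.
  apply: eq_bigr => j _; rewrite /= mevalZ mderivX mevalZ mulrCA.
  have [->|mj] := eqVneq (m j) 0%N; first by rewrite !mul0r.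
  congr (_ * _); have -> : z ord0 j = ('X_j : {mpoly R[i][n]}).@[z ord0].
    by rewrite mevalXU.
  rewrite -mevalM -mpolyXD addmC submK //.
  by apply/mnm_lepP => l; rewrite mnm1E; case: (j =P l) => [<-|_]; rewrite ?lt0n.
have d_hom d (q : {mpoly R[i][n]}) : q \is d.+1.-homog ->
    dirderiv z q \is d.-homog.
  move=> hq; rewrite /dirderiv rpred_sum // => j _; apply: rpredZ.
  apply/dhomogP => m; rewrite mcoeff_msupp mcoeff_deriv => nz.
  have : (m + U_(j))%MM \in msupp q.
    by rewrite mcoeff_msupp; apply: contraNneq nz => ->; rewrite mul0rn.
  by move/(dhomog_mf hq); rewrite /= mdegD mdeg1 addn1 => -[].
have euler d (q : {mpoly R[i][n]}) : q \is d.-homog ->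
    (dirderiv z q).@[z ord0] = d%:R * q.@[z ord0].
  move=> hq; have -> : dirderiv z q =
      \sum_(m <- msupp q) q@_m *: dirderiv z 'X_[m].
    transitivity (\sum_(m <- msupp q) \sum_(j < n)
        q@_m *: (z ord0 j *: 'X_[m]^`M(j))); last first.
      by apply: eq_bigr => m _; rewrite scaler_sumr.
    rewrite exchange_big; apply: eq_bigr => j _ /=.
    rewrite [q in LHS]mpolyE (raddf_sum (mderiv j)) scaler_sumr.
    apply: eq_bigr => m _.
    by rewrite /= mderivZ !scalerA mulrC.
  rewrite [q in RHS]mpolyE !raddf_sum mulr_sumr /=.
  rewrite big_seq [RHS]big_seq; apply: eq_bigr => m m_q.
  by rewrite !mevalZ dX (dhomog_mf hq m_q) mulrCA.
have iterd d (q : {mpoly R[i][n]}) : q \is d.-homog ->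
    (foldr (@dirderiv R n) q (nseq d z)).@[(0 : 'rV[R[i]]_n) ord0] =
    d`!%:R * q.@[z ord0].
  elim: d q => [|d IHd] q hq.
    suff -> : q = (q@_0)%:MP by rewrite /= !mevalC mul1r.
    apply/mpolyP => m; rewrite mcoeffC.
    have [->|nm] := eqVneq 0%MM m; first by rewrite mulr1.
    by rewrite mulr0 (dhomog_nemf_coeff hq) //= mdeg_eq0 eq_sym.
  have -> : nseq d.+1 z = rcons (nseq d z) z.
    by elim: (d) => //= e <-.
  rewrite foldr_rcons IHd; last exact: d_hom.
  by rewrite (euler _ _ hq) factS mulnC natrM mulrA.
rewrite /pairing (@symdiff_prod _ _ _ _ _ _ (nseq k z)); last first.
  by rewrite def_w big_nseq iter_mulr_1.
by rewrite iterd ?dhomog_is_dhomog // mulKf // pnatr_eq0 -lt0n fact_gt0.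
Qed.

(* The norms are attained suprema, the spaces being finite dimensional. *)
Definition sympow_norm (R : realType) (n k : nat) (w : sympow R n k) : R :=
  sup [set normc (pairing h w) | h in [set h : sympow R n k | form_norm h <= 1]].

Definition symdiff_norm (R : realType) (n k : nat) (f : {mpoly R[i][n]})
    (p : 'rV[R[i]]_n) : R :=
  sup [set normc (symdiff f p w) | w in [set w : sympow R n k | sympow_norm w = 1]].

(* Main.v *)
Require Import Defs.
From mathcomp Require Import all_boot all_order all_algebra.
From mathcomp Require Import complex mpoly.
From mathcomp Require Import boolp classical_sets functions reals topology.
From mathcomp Require Import normedtype.
From mathcomp Require Import ring ssrcomplements.
Import Order.TTheory GRing.Theory Num.Theory.
Import ComplexField.Normc.
Local Open Scope complex_scope.
Local Open Scope ring_scope.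

Set Implicit Arguments.
Unset Strict Implicit.
Unset Printing Implicit Defensive.

(** Write [v = zeta - zhat].  Restricting [f] to the line [t |-> zhat + t v]
    gives the Taylor expansion of [f zeta], whose [k]-th term is
    [(D^k f)_zhat (v^k) / k!].  In the Bombieri-Weyl norm the duality pairing
    satisfies the Cauchy-Schwarz inequality, and [v^k] has norm [|v|^k] by the
    multinomial theorem; hence the dual norm of [v^k] is at most
    [|v|^k <= rho^k].  Every term with [0 < k] is thus bounded by
    [|(D^k f)_zhat| rho^k / k!], and the triangle inequality concludes.

    Since [sup] of an unbounded set is [0], the two suprema defining the norms
    must be shown to be bounded; for the operator norm this holds because
    [(D^k f)_p] is itself the pairing with a form. *)

(** * The modulus of complex numbers and the Cauchy-Schwarz inequality *)

Lemma normc_real (R : realType) (x : R) : normc x%:C = `|x|.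
Proof. by rewrite /normc /= expr0n addr0 sqrtr_sqr. Qed.

Lemma normc_ge0 (R : realType) (z : R[i]) : 0 <= normc z.
Proof. by case: z => a b; exact: sqrtr_ge0. Qed.

Lemma normc_nat (R : realType) (k : nat) : normc (k%:R : R[i]) = k%:R.
Proof. by rewrite -(rmorph_nat (real_complex R)) normc_real normr_nat. Qed.

Lemma normcX (R : realType) (z : R[i]) (k : nat) :
  normc (z ^+ k) = normc z ^+ k.
Proof.
by elim: k => [|k IHk]; rewrite ?normc1 // !exprS normcM IHk.
Qed.

Lemma normc_prod (R : realType) (I : Type) (s : seq I) (F : I -> R[i]) :
  normc (\prod_(j <- s) F j) = \prod_(j <- s) normc (F j).
Proof. exact: (big_morph _ (@normcM R) (@normc1 R)). Qed.

Lemma le_normc_sum (R : realType) (I : Type) (s : seq I) (F : I -> R[i]) :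
  normc (\sum_(j <- s) F j) <= \sum_(j <- s) normc (F j).
Proof.
elim: s => [|j s IHs]; first by rewrite !big_nil normc0.
by rewrite !big_cons; apply: le_trans (le_normcD _ _) _; rewrite lerD2l.
Qed.

(** Lagrange's identity: the gap between the two sides is half the sum of the squared minors
    [a j * b l - a l * b j]. *)
Lemma sum_cauchy_schwarz (R : realFieldType) (I : finType) (a b : I -> R) :
  (\sum_j a j * b j) ^+ 2 <= (\sum_j a j ^+ 2) * (\sum_j b j ^+ 2).
Proof.
have : 0 <= \sum_j \sum_l (a j * b l - a l * b j) ^+ 2.
  by apply: sumr_ge0 => j _; apply: sumr_ge0 => l _; exact: sqr_ge0.
have -> : \sum_j \sum_l (a j * b l - a l * b j) ^+ 2 =
    \sum_j \sum_l (a j ^+ 2 * b l ^+ 2) + \sum_j \sum_l (a l ^+ 2 * b j ^+ 2)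
    - (\sum_j \sum_l (a j * b j) * (a l * b l)) *+ 2.
  rewrite -sumrMnl -!big_split -sumrB /=; apply: eq_bigr => j _.
  rewrite -sumrMnl -!big_split -sumrB /=; apply: eq_bigr => l _.
  by ring.
rewrite [X in _ + X - _]exchange_big /= -big_distrlr.
under [X in _ - X *+ 2]eq_bigr do rewrite -mulr_sumr.
rewrite -mulr_suml -expr2 -mulr2n -mulrnBl pmulrn_lge0 // subr_ge0.
by [].
Qed.

(** * The pairing and the form norm in monomial coordinates *)

Definition mfact (n : nat) (m : 'X_{1..n}) : nat := \prod_(j < n) (m j)`!.

Lemma mfact_gt0 (n : nat) (m : 'X_{1..n}) : (0 < mfact m)%N.
Proof. by apply: prodn_gt0 => j; exact: fact_gt0. Qed.

(** At the origin only the constant coefficient of the derivative survives. It comes from the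
    monomial ['X_[m]], whose exponents yield the falling factorials [(m j)!]. *)
Lemma meval_mderivm0 (R : realType) (n : nat) (p : {mpoly R[i][n]})
    (m : 'X_{1..n}) :
  (p^`M[m]).@[(0 : 'rV[R[i]]_n) ord0] = p@_m * (mfact m)%:R.
Proof.
have ev0 (q : {mpoly R[i][n]}) : q.@[(0 : 'rV[R[i]]_n) ord0] = q@_0.
  rewrite {1}[q]mpolyE [in RHS](mpolyE q) !raddf_sum /=.
  apply: eq_bigr => m' _; rewrite mevalZ mcoeffZ mevalX mcoeffX; congr (_ * _).
  have [->|nz] := eqVneq m' 0%MM.
    by rewrite big1 // => j _; rewrite mnm0E expr0.
  have [j nzj] : exists j, m' j != 0%N.
    apply/existsP; apply: contraNT nz => /existsPn z; apply/eqP/mnmP => j.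
    by rewrite mnm0E; apply/eqP; rewrite -[_ == _]negbK.
  by rewrite (bigD1 j) //= mxE expr0n (negbTE nzj) mul0r.
rewrite ev0 mcoeff_mderivm addm0 mulr_natr; congr (_ *+ _).
by apply: eq_bigr => j _; rewrite ffactnn.
Qed.

Lemma sympow_msize (R : realType) (n k : nat) (w : sympow R n k) :
  (msize (val w) <= k.+1)%N.
Proof.
rewrite msizeE; apply/bigmax_leqP_seq => m m_w _.
by rewrite (dhomog_mf (valP w) m_w).
Qed.

(** The monomial basis makes the pairing diagonal, with the weights [m! / k!] that also occur in the
    squared [form_norm]; this match is what lets Cauchy-Schwarz compare the two. *)
Lemma pairingE (R : realType) (n k : nat) (h w : sympow R n k) :
  pairing h w = \sum_(m : 'X_{1..n < k.+1})
    (val h)@_m * (val w)@_m * ((mfact m)%:R / k`!%:R).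
Proof.
rewrite /pairing (symdiffwE _ _ (sympow_msize w)) mulr_sumr.
by apply: eq_bigr => m _; rewrite meval_mderivm0; ring.
Qed.

Lemma sqr_form_norm (R : realType) (n k : nat) (h : sympow R n k) :
  form_norm h ^+ 2 = \sum_(m : 'X_{1..n < k.+1})
    normc (val h)@_m ^+ 2 * ((mfact m)%:R / k`!%:R).
Proof.
rewrite /form_norm sqr_sqrtr; last first.
  by apply: sumr_ge0 => m _; rewrite mulr_ge0 ?sqr_ge0 // divr_ge0 ?prodr_ge0.
rewrite (big_mksub 'X_{1..n < k.+1}) /=; first last.
- by move=> m /msize_mdeg_lt/leq_trans; apply; exact: sympow_msize.
- exact: msupp_uniq.
rewrite big_rmcond /= => [|m /memN_msupp_eq0 ->]; last first.
  by rewrite normc0 expr0n mul0r.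
by apply: eq_bigr => m _; rewrite natr_prod.
Qed.

Lemma form_norm_ge0 (R : realType) (n k : nat) (h : sympow R n k) :
  0 <= form_norm h.
Proof. exact: sqrtr_ge0. Qed.

Lemma form_normZ (R : realType) (n k : nat) (c : R[i]) (h : sympow R n k) :
  form_norm (c *: h) = normc c * form_norm h.
Proof.
apply/eqP; rewrite -(@eqrXn2 _ 2) ?mulr_ge0 ?form_norm_ge0 ?normc_ge0 //.
rewrite exprMn !sqr_form_norm mulr_sumr; apply/eqP/eq_bigr => m _.
by rewrite /= mcoeffZ normcM exprMn -mulrA.
Qed.

Lemma pairingZl (R : realType) (n k : nat) (c : R[i]) (h w : sympow R n k) :
  pairing (c *: h) w = c * pairing h w.
Proof.
by rewrite !pairingE mulr_sumr; apply: eq_bigr => m _; rewrite mcoeffZ !mulrA.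
Qed.

Lemma symdiffZ (R : realType) (n k : nat) (f : {mpoly R[i][n]})
    (p : 'rV[R[i]]_n) (c : R[i]) (w : sympow R n k) :
  symdiff f p (c *: w) = c * symdiff f p w.
Proof.
have z : symdiff f p (0 : sympow R n k) = 0 by rewrite /symdiff msupp0 big_nil.
by rewrite -[c *: w]addr0 symdiff_is_linear z addr0.
Qed.

Lemma pairingZr (R : realType) (n k : nat) (c : R[i]) (h w : sympow R n k) :
  pairing h (c *: w) = c * pairing h w.
Proof. by rewrite /pairing symdiffZ mulrCA. Qed.

(** * Cauchy-Schwarz for the pairing, and the dual norm *)

Lemma normc_pairing_le (R : realType) (n k : nat) (h w : sympow R n k) :
  normc (pairing h w) <= form_norm h * form_norm w.
Proof.
rewrite -(@ler_pXn2r _ 2) ?nnegrE ?mulr_ge0 ?form_norm_ge0 ?normc_ge0 //.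
(* The square root of the weight, so that each of the two factors absorbs half of it. *)
pose c m : R := Num.sqrt ((@mfact n m)%:R / k`!%:R).
have c2 m : c m ^+ 2 = (mfact m)%:R / k`!%:R by rewrite sqr_sqrtr // divr_ge0.
pose a (h : sympow R n k) (m : 'X_{1..n < k.+1}) := normc (val h)@_m * c m.
have sqn (h' : sympow R n k) : form_norm h' ^+ 2 = \sum_m a h' m ^+ 2.
  by rewrite sqr_form_norm; apply: eq_bigr => m _; rewrite exprMn c2.
rewrite exprMn !sqn; apply: le_trans (sum_cauchy_schwarz _ _).
rewrite lerXn2r ?nnegrE ?normc_ge0 //.
  by apply: sumr_ge0 => m _; rewrite !mulr_ge0 ?normc_ge0 ?sqrtr_ge0.
rewrite pairingE; apply: le_trans (le_normc_sum _ _) _.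
apply: ler_sum => m _; rewrite !normcM normcV !normc_nat -c2 /a.
by rewrite le_eqVlt; apply/orP; left; apply/eqP; ring.
Qed.

Lemma has_ubound_sympow_norm (R : realType) (n k : nat) (w : sympow R n k) :
  has_ubound [set normc (pairing h w) |
    h in [set h : sympow R n k | form_norm h <= 1]]%classic.
Proof.
exists (form_norm w) => _ [h /= le_h1 <-].
apply: le_trans (normc_pairing_le h w) _.
by rewrite ler_piMl // form_norm_ge0.
Qed.

Lemma form_norm0 (R : realType) (n k : nat) :
  form_norm (0 : sympow R n k) = 0.
Proof. by rewrite -(scale0r 0) form_normZ normc0 mul0r. Qed.

Lemma sympow_norm_le (R : realType) (n k : nat) (w : sympow R n k) (b : R) :
  (forall h, form_norm h <= 1 -> normc (pairing h w) <= b) ->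
  sympow_norm w <= b.
Proof.
move=> le_b; apply: ge_sup => [|_ [h /= le_h1 <-]]; last exact: le_b.
by exists (normc (pairing 0 w)); exists 0; rewrite //= form_norm0 ler01.
Qed.

Lemma sympow_norm_le_form_norm (R : realType) (n k : nat)
    (w : sympow R n k) : sympow_norm w <= form_norm w.
Proof.
apply: sympow_norm_le => h le_h1; apply: le_trans (normc_pairing_le h w) _.
by rewrite ler_piMl // form_norm_ge0.
Qed.

Lemma sympow_norm_ge0 (R : realType) (n k : nat) (w : sympow R n k) :
  0 <= sympow_norm w.
Proof.
apply: le_trans (normc_ge0 (pairing 0 w)) _.
apply: (ub_le_sup (has_ubound_sympow_norm w)).
by exists 0; rewrite //= form_norm0 ler01.
Qed.

Lemma normc_pairing_le_sympow_norm (R : realType) (n k : nat)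
    (h w : sympow R n k) :
  normc (pairing h w) <= form_norm h * sympow_norm w.
Proof.
(* A form of norm 0 cannot be rescaled to norm 1; there Cauchy-Schwarz already gives the bound 0. *)
have [h0|nz_h] := eqVneq (form_norm h) 0.
  by have := normc_pairing_le h w; rewrite h0 !mul0r.
have h_gt0 : 0 < form_norm h by rewrite lt0r nz_h form_norm_ge0.
pose c : R[i] := (form_norm h)^-1%:C.
have nc : normc c = (form_norm h)^-1.
  by rewrite normc_real ger0_norm // invr_ge0 ltW.
rewrite -ler_pdivrMl // -nc -normcM -pairingZl.
apply: (ub_le_sup (has_ubound_sympow_norm w)).
by exists (c *: h); rewrite //= form_normZ nc mulVf.
Qed.

Lemma sympow_normZ (R : realType) (n k : nat) (c : R[i]) (w : sympow R n k) :
  sympow_norm (c *: w) = normc c * sympow_norm w.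
Proof.
have le_cw d (u : sympow R n k) :
    sympow_norm (d *: u) <= normc d * sympow_norm u.
  apply: sympow_norm_le => h le_h1; rewrite pairingZr normcM.
  rewrite ler_wpM2l ?normc_ge0 //.
  by apply: (ub_le_sup (has_ubound_sympow_norm u)); exists h.
apply/eqP; rewrite eq_le le_cw /=.
have [->|nz_c] := eqVneq c 0; first by rewrite normc0 mul0r sympow_norm_ge0.
have c_gt0 : 0 < normc c.
  rewrite lt0r normc_ge0 andbT; apply: contra nz_c => /eqP/eq0_normc ->.
  exact: eqxx.
(* The reverse inequality is [le_cw] for the scalar [c^-1] and the tensor [c *: w]. *)
by rewrite -ler_pdivlMl // -normcV -{1}[w](scalerK nz_c) le_cw.
Qed.

(** * Derivatives as pairings, and the operator norm *)

Lemma symdiff_pairing (R : realType) (n k : nat) (f : {mpoly R[i][n]})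
    (p : 'rV[R[i]]_n) :
  exists h : sympow R n k, forall w, symdiff f p w = k`!%:R * pairing h w.
Proof.
(* The degree [k] part of the Taylor expansion of [f] at [p]; dividing by [m!] cancels the numerator
   of the pairing weight. *)
pose q : {mpoly R[i][n]} := \sum_(m : 'X_{1..n < k.+1} | mdeg m == k)
  ((f^`M[m]).@[p ord0] / (mfact m)%:R) *: 'X_[m].
have q_hom : q \is k.-homog.
  by apply: rpred_sum => m /eqP deg_m; rewrite rpredZ // dhomogX; apply/eqP.
exists (DHomog q_hom) => w; rewrite pairingE mulr_sumr.
rewrite (symdiffwE _ _ (sympow_msize w)); apply: eq_bigr => m _ /=.
have nzk : k`!%:R != 0 :> R[i] by rewrite pnatr_eq0 -lt0n fact_gt0.
have nzm : (mfact m)%:R != 0 :> R[i] by rewrite pnatr_eq0 -lt0n mfact_gt0.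
have [deg_m|ndeg_m] := eqVneq (mdeg m) k; last first.
  by rewrite (dhomog_nemf_coeff (valP w)) // mul0r mulr0 mul0r mulr0.
have -> : q@_m = (f^`M[m]).@[p ord0] / (mfact m)%:R.
  rewrite /q raddf_sum (bigD1 m) /=; last by rewrite deg_m.
  rewrite mcoeffZ mcoeffX eqxx mulr1 big1 ?addr0 // => m' /andP[_ ne_m'm].
  by rewrite mcoeffZ mcoeffX -bmeqP (negbTE ne_m'm) mulr0.
by field; rewrite nzk nzm.
Qed.

Lemma normc_symdiff_bound (R : realType) (n k : nat) (f : {mpoly R[i][n]})
    (p : 'rV[R[i]]_n) :
  exists C, forall w : sympow R n k,
    normc (symdiff f p w) <= C * sympow_norm w.
Proof.
have [h symdiffE] := symdiff_pairing k f p.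
exists (k`!%:R * form_norm h) => w.
rewrite symdiffE normcM normc_nat -mulrA ler_wpM2l //.
exact: normc_pairing_le_sympow_norm.
Qed.

Lemma has_ubound_symdiff_norm (R : realType) (n k : nat) (f : {mpoly R[i][n]})
    (p : 'rV[R[i]]_n) :
  has_ubound [set normc (symdiff f p w) |
    w in [set w : sympow R n k | sympow_norm w = 1]]%classic.
Proof.
have [C le_C] := normc_symdiff_bound k f p.
by exists C => _ [w /= w1 <-]; have := le_C w; rewrite w1 mulr1.
Qed.

Lemma normc_symdiff_le (R : realType) (n k : nat) (f : {mpoly R[i][n]})
    (p : 'rV[R[i]]_n) (w : sympow R n k) :
  normc (symdiff f p w) <= symdiff_norm k f p * sympow_norm w.
Proof.
(* Normalising [w] is impossible here, but boundedness forces the derivative to vanish on [w]. *)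
have [w0|nz_w] := eqVneq (sympow_norm w) 0.
  have [C le_C] := normc_symdiff_bound k f p.
  by have := le_C w; rewrite w0 !mulr0.
have w_gt0 : 0 < sympow_norm w by rewrite lt0r nz_w sympow_norm_ge0.
pose c : R[i] := (sympow_norm w)^-1%:C.
have nc : normc c = (sympow_norm w)^-1.
  by rewrite normc_real ger0_norm // invr_ge0 ltW.
rewrite -ler_pdivrMr // mulrC -nc -normcM -symdiffZ.
apply: (ub_le_sup (has_ubound_symdiff_norm k f p)).
by exists (c *: w); rewrite //= sympow_normZ nc mulVf.
Qed.

Lemma symdiff_norm_ge0 (R : realType) (n k : nat) (f : {mpoly R[i][n]})
    (p : 'rV[R[i]]_n) : 0 <= symdiff_norm k f p.
Proof.
(* There may be no unit tensor, as when [n = 0 < k] and the space is zero; the supremum of the empty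
   set is then 0. *)
have [[w w1]|none] := pselect (exists w : sympow R n k, sympow_norm w = 1).
  apply: le_trans (normc_ge0 (symdiff f p w)) _.
  by apply: (ub_le_sup (has_ubound_symdiff_norm k f p)); exists w.
by rewrite /symdiff_norm sup_out // => -[[_ [w w1 _]] _]; apply: none; exists w.
Qed.

(** * Powers of a vector and their norm *)

Lemma symvec_homog (R : realType) (n k : nat) (v : 'rV[R[i]]_n) :
  symvec v ^+ k \is k.-homog.
Proof.
rewrite -[X in X.-homog]mul1n dhomogMn // rpred_sum // => j _.
by rewrite rpredZ // dhomogX /= mdeg1.
Qed.

Definition sympow_vec (R : realType) (n k : nat) (v : 'rV[R[i]]_n) :
  sympow R n k := DHomog (symvec_homog k v).

Lemma mcoeff_symvecX (R : realType) (n k : nat) (v : 'rV[R[i]]_n)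
    (m : 'X_{1..n}) : mdeg m = k ->
  (symvec v ^+ k)@_m = k`!%:R / (mfact m)%:R * \prod_(j < n) v ord0 j ^+ m j.
Proof.
move=> deg_m; have Xm_hom : 'X_[m] \is [in R[i][n], k.-homog].
  by rewrite dhomogX; apply/eqP.
(* Pairing [v^k] with the monomial [X^m] gives [v^m] and isolates the
   coefficient at [m]. *)
have := @pairing_pow R n k (DHomog Xm_hom) (sympow_vec k v) v erefl.
have lt_mk : (mdeg m < k.+1)%N by rewrite deg_m.
rewrite pairingE mevalX (bigD1 (BMultinom lt_mk)) //= big1 => [|m' ne_m'].
  rewrite mcoeffX eqxx mul1r addr0 => <-.
  have nzk : k`!%:R != 0 :> R[i] by rewrite pnatr_eq0 -lt0n fact_gt0.
  have nzm : (mfact m)%:R != 0 :> R[i] by rewrite pnatr_eq0 -lt0n mfact_gt0.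
  by field; rewrite nzk nzm.
rewrite mcoeffX; case: eqP => [eq_m|_]; last by rewrite !mul0r.
by case/eqP: ne_m'; exact/val_inj.
Qed.

Lemma form_norm_sympow_vec (R : realType) (n k : nat) (v : 'rV[R[i]]_n) :
  form_norm (sympow_vec k v) = hermitian_norm v ^+ k.
Proof.
have s_ge0 : 0 <= \sum_(j < n) normc (v ord0 j) ^+ 2.
  by apply: sumr_ge0 => j _; exact: sqr_ge0.
apply/eqP; rewrite -(@eqrXn2 _ 2) ?exprn_ge0 ?form_norm_ge0 ?sqrtr_ge0 //.
rewrite sqr_form_norm -exprM mulnC exprM sqr_sqrtr //; apply/eqP.
(* The multinomial theorem, in the form of the expansion of [symvec a ^+ k]
   evaluated at [(1, ..., 1)], where [a j = |v j|^2]. *)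
pose a : 'rV[R[i]]_n := \row_j (normc (v ord0 j) ^+ 2)%:C.
apply: (@complexI R); rewrite rmorphXn !rmorph_sum /=.
have -> : \sum_(j < n) (normc (v ord0 j) ^+ 2)%:C =
    (symvec a).@[fun=> 1].
  rewrite raddf_sum; apply: eq_bigr => j _.
  by rewrite /= mevalZ mevalXU mulr1 mxE.
rewrite -rmorphXn /=.
rewrite (@mpolywE _ _ _ (symvec a ^+ k) (sympow_msize (sympow_vec k a))).
rewrite raddf_sum; apply: eq_bigr => m _ /=.
rewrite mevalZ mevalX big1 => [|j _]; last by rewrite expr1n.
rewrite mulr1; have [deg_m|ndeg_m] := eqVneq (mdeg m) k; last first.
  by rewrite !(dhomog_nemf_coeff (symvec_homog _ _)) // normc0 expr0n mul0r.
(* The weight [m! / k!] cancels one factor of the squared multinomial coefficient, leaving the term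
   of the multinomial expansion. *)
rewrite !mcoeff_symvecX // !normcM normcV !normc_nat normc_prod.
under [in RHS]eq_bigr => j _ do rewrite mxE -rmorphXn /= -exprM mulnC exprM.
under [in LHS]eq_bigr => j _ do rewrite normcX.
rewrite -rmorph_prod prodrXl -!(rmorph_nat (real_complex R)) -fmorphV -!rmorphM.
congr (_%:C).
have nzk : k`!%:R != 0 :> R by rewrite pnatr_eq0 -lt0n fact_gt0.
have nzm : (mfact m)%:R != 0 :> R by rewrite pnatr_eq0 -lt0n mfact_gt0.
by field; rewrite nzk nzm.
Qed.

(** * Restriction to a line and Taylor expansion *)

Definition line_restriction (R : realType) (n : nat) (p v : 'rV[R[i]]_n) :
    {mpoly R[i][n]} -> {poly R[i]} :=
  mmap (@polyC R[i]) (fun j => (p ord0 j)%:P + v ord0 j *: 'X).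

(** The chain rule. The polynomials satisfying it contain the constants and the variables, and are
    closed under sums and, by the Leibniz rule, products. *)
Lemma deriv_line_restriction (R : realType) (n : nat) (p v : 'rV[R[i]]_n)
    (f : {mpoly R[i][n]}) :
  (line_restriction p v f)^`() = line_restriction p v (dirderiv v f).
Proof.
rewrite /line_restriction; set L := mmap _ _.
have D_C c : dirderiv v c%:MP = 0.
  by rewrite /dirderiv big1 // => j _; rewrite mderivC scaler0.
have D_D q r : dirderiv v (q + r) = dirderiv v q + dirderiv v r.
  by rewrite -big_split; apply: eq_bigr => j _; rewrite mderivD scalerDr.
have D_M q r : dirderiv v (q * r) = dirderiv v q * r + q * dirderiv v r.
  rewrite /dirderiv mulr_suml mulr_sumr -big_split; apply: eq_bigr => j _ /=.
  by rewrite mderivM scalerDr -scalerAl -scalerAr.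
pose P q := (L q)^`() = L (dirderiv v q); rewrite -/(P f).
have P_C c : P c%:MP by rewrite /P D_C /L mmapC derivC raddf0.
have P_M q r : P q -> P r -> P (q * r).
  rewrite /P => Pq Pr.
  by rewrite D_M /L rmorphM derivM rmorphD !rmorphM /= Pq Pr.
have P_D q r : P q -> P r -> P (q + r).
  by rewrite /P => Pq Pr; rewrite D_D /L !rmorphD derivD /= Pq Pr.
have P_X j : P 'X_j.
  rewrite /P /L mmapX mmap1U derivD derivC derivZ derivX add0r alg_polyC.
  rewrite /dirderiv (bigD1 j) //= big1 => [|l ne_lj].
    rewrite mderivX mnm1E eqxx addr0 scale1r -{1}[mnm1 j]add0m addmK mpolyX0.
    by rewrite -mul_mpolyC mulr1 mmapC.
  by rewrite mderivX mnm1E eq_sym (negbTE ne_lj) scale0r scaler0.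
have P_0 := P_C 0; rewrite mpolyC0 in P_0.
have P_1 := P_C 1; rewrite mpolyC1 in P_1.
clearbody P; elim/mpolyind: f => // c m q _ _; apply: P_D.
rewrite -mul_mpolyC; apply: (P_M) => //; rewrite mpolyXE_id.
apply: big_ind => // j _; elim: (m j) => // d IHd.
by rewrite exprS; exact: P_M.
Qed.

Lemma horner_line_restriction (R : realType) (n : nat) (p v : 'rV[R[i]]_n)
    (f : {mpoly R[i][n]}) (t : R[i]) :
  (line_restriction p v f).[t] = f.@[(p + t *: v) ord0].
Proof.
rewrite mevalE horner_sum; apply: eq_bigr => m _.
rewrite hornerM hornerC horner_prod; congr (_ * _); apply: eq_bigr => j _.
by rewrite horner_exp hornerD hornerC hornerZ hornerX !mxE mulrC.
Qed.

(** Each variable is replaced by a polynomial of degree at most 1, so a monomial cannot gain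
    degree. *)
Lemma size_line_restriction (R : realType) (n : nat) (p v : 'rV[R[i]]_n)
    (f : {mpoly R[i][n]}) :
  (size (line_restriction p v f) <= msize f)%N.
Proof.
apply: leq_trans (size_sum _ _ _) _; apply/bigmax_leqP_seq => m m_f _.
apply: leq_trans (msize_mdeg_lt m_f); rewrite mul_polyC.
apply: leq_trans (size_scale_leq _ _) _; rewrite mdegE.
apply: (big_ind2 (fun (q : {poly R[i]}) d => size q <= d.+1)%N).
- by rewrite size_poly1.
- move=> q d r e le_q le_r; apply: leq_trans (size_polyMleq _ _) _.
  by have := leq_add le_q le_r; case: (_ + _)%N => //= s; rewrite addnS addSn.
move=> j _; apply: leq_trans (size_poly_exp_leq _ _) _.
rewrite ltnS -[leqRHS]mul1n leq_mul2r -subn1 leq_subLR; apply/orP; right.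
apply: leq_trans (size_polyD _ _) _; rewrite geq_max.
rewrite (leq_trans (size_polyC_leq1 _)) //.
by rewrite (leq_trans (size_scale_leq _ _)) // size_polyX.
Qed.

Lemma taylor_symdiff (R : realType) (n : nat) (p v : 'rV[R[i]]_n)
    (f : {mpoly R[i][n]}) :
  f.@[(p + v) ord0] =
  \sum_(k < msize f) symdiff f p (sympow_vec k v) / k`!%:R.
Proof.
(* Univariate Taylor expansion at 0 with increment 1. *)
have := nderiv_taylor_wide (commr1 0) (size_line_restriction p v f).
rewrite add0r horner_line_restriction scale1r => ->; apply: eq_bigr => k _.
rewrite expr1n mulr1 (@symdiff_prod _ _ _ _ _ _ (nseq k v)); last first.
  by rewrite big_nseq iter_mulr_1.
have -> : (foldr (@dirderiv R n) f (nseq k v)).@[p ord0] =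
    (line_restriction p v f)^`(k).[0].
  rewrite -{1}[p](addr0 p) -(scale0r v) -horner_line_restriction; congr _.[_].
  by elim: (nat_of_ord k) => //= l IHl; rewrite -deriv_line_restriction IHl.
rewrite nderivn_def hornerMn -mulr_natr mulfK //.
by rewrite pnatr_eq0 -lt0n fact_gt0.
Qed.

Theorem proposition2p4 (R : realType) (n : nat)
    (g : n.-tuple {mpoly R[i][n]}) (zhat : 'rV[R[i]]_n) (rho : R)
    (U : set 'rV[R[i]]_n) (N : U -> 'rV[R[i]]_n) (zeta : 'rV[R[i]]_n)
    (approx : approximate_solution g zhat rho N)
    (assoc : associated_solution g zhat rho N zeta)
    (f : {mpoly R[i][n]}) :
  0 < normc f.@[zhat ord0]
      - \sum_(1 <= k < msize f) symdiff_norm k f zhat / k`!%:R * rho ^+ k ->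
  f.@[zeta ord0] <> 0.
Proof.
move=> pos f0; case: assoc => _ lt_rho _.
(* As [msize] is the degree plus one, it is 0 only for [f = 0]; otherwise the Taylor sum has a term
   [k = 0] to split off. *)
have [f_eq0|f_gt0] := posnP (msize f).
  move/eqP: f_eq0; rewrite msize_poly_eq0 => /eqP f_eq0; move: pos.
  by rewrite f_eq0 msize0 big_geq // meval0 normc0 subr0 ltxx.
have := taylor_symdiff zhat (zeta - zhat) f.
rewrite addrC subrK f0 => /esym/eqP.
rewrite -(big_mkord predT (fun k => symdiff f zhat
  (sympow_vec k (zeta - zhat)) / k`!%:R)) big_ltn //.
(* The power with exponent 0 is the empty product, so this term is [f] at [zhat]. *)
rewrite (@symdiff_prod _ _ _ _ _ _ [::]); last by rewrite /= big_nil.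
rewrite /= fact0 divr1 addr_eq0 => /eqP fE; move: pos.
(* Since [f] vanishes at [zeta], its value at [zhat] is minus the sum of the higher terms; bounding
   that sum contradicts [pos]. *)
rewrite fE normcN subr_gt0 ltNge => /negP; apply.
apply: le_trans (le_normc_sum _ _) _; apply: ler_sum => k _.
rewrite normcM normcV normc_nat mulrAC ler_wpM2r ?invr_ge0 //.
apply: le_trans (normc_symdiff_le _ _ _) _.
apply: ler_wpM2l; first exact: symdiff_norm_ge0.
apply: le_trans (sympow_norm_le_form_norm _) _.
rewrite form_norm_sympow_vec lerXn2r ?nnegrE ?sqrtr_ge0 //; last exact: ltW.
exact: le_trans (sqrtr_ge0 _) (ltW lt_rho).
Qed.
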